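(* Let $\lambda>0$ and $f\in C^\infty((0,\infty))$. The relation $$T^{\lambda}_{n,k}(f)(x)=(-1)^n\left(c_k^{\lambda}(f)\right)^{(n)}(x)$$ holds for all integers $n,k\geq 0$ and all $x>0$.
   Context: For $\lambda>0$, integers $n,k\geq 0$ and $f\in C^\infty((0,\infty))$, $$T_{n,k}^{\lambda}(f)(x)=(-1)^nx^{-(n+\lambda-1)}\left(x^{k+n+\lambda-1}f^{(n)}(x)\right)^{(k)},\qquad c_k^{\lambda}(f)(x)=x^{1-\lambda}\left(x^{\lambda-1+k}f(x)\right)^{(k)},$$ where $^{(k)}$ denotes the $k$-th derivative with respect to $x$. *)

(* Defs.v *)
From Stdlib Require Import Reals.
From Coquelicot Require Import Coquelicot.
Open Scope R_scope.

(* A function on (0,oo) is represented by a total function R -> R whose values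
   outside (0,oo) play no role: at x > 0, [Derive_n] depends only on the values
   near x. *)
Definition smooth_pos (f : R -> R) : Prop :=
  forall (m : nat) (x : R), 0 < x -> ex_derive_n f m x.

(* [Rpower x a] is x^a for x > 0. *)
Definition T (lambda : R) (n k : nat) (f : R -> R) (x : R) : R :=
  (-1) ^ n * Rpower x (- (INR n + lambda - 1)) *
  Derive_n (fun t => Rpower t (INR k + INR n + lambda - 1) * Derive_n f n t) k x.

Definition c (lambda : R) (k : nat) (f : R -> R) (x : R) : R :=
  Rpower x (1 - lambda) *
  Derive_n (fun t => Rpower t (lambda - 1 + INR k) * f t) k x.

(* Main.v *)
(* With theta = x d/dx, one has c_{k+1}^lambda f = c_k^lambda ((theta + lambda + k) f),
   so that c_k^lambda = prod_{j<k} (theta + lambda + j). Since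
   d/dx theta = (theta + 1) d/dx, this gives (c_k^lambda f)' = c_k^{lambda+1} f',
   and iterating n times gives (c_k^lambda f)^(n) = c_k^{lambda+n} f^(n),
   which is (-1)^n T_{n,k}^lambda f. *)
Require Import Defs.
From Stdlib Require Import Reals.
From Coquelicot Require Import Coquelicot.
Open Scope R_scope.

(** The half-line is open, so identities valid only for positive arguments can be used under
    [Derive] and [Derive_n]. *)
Lemma locally_pos (P : R -> Prop) (x : R) :
  0 < x -> (forall t, 0 < t -> P t) -> locally x P.
Proof.
intros hx HP.
exact (filter_imp _ _ HP (open_gt 0 x hx)).
Qed.

Lemma is_derive_Rpower (a x : R) :
  0 < x -> is_derive (fun t => Rpower t a) x (a * Rpower x (a - 1)).
Proof.
intros hx; apply is_derive_Reals; now apply derivable_pt_lim_power.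
Qed.

Lemma smooth_pos_is_derive (f : R -> R) (n : nat) (x : R) :
  smooth_pos f -> 0 < x -> is_derive (Derive_n f n) x (Derive_n f (S n) x).
Proof.
intros hf hx; apply Derive_correct; exact (hf (S n) x hx).
Qed.

Lemma smooth_pos_Derive (f : R -> R) : smooth_pos f -> smooth_pos (Derive f).
Proof.
intros hf [|m] x hx; [exact I|].
apply ex_derive_ext with (Derive_n f (S m)).
- intros t; rewrite <- Nat.add_1_r; symmetry; exact (Derive_n_comp f m 1 t).
- exact (hf (S (S m)) x hx).
Qed.

(** The first-order operator theta + b, with theta = t d/dt. *)
Definition euler (b : R) (f : R -> R) (t : R) : R := b * f t + t * Derive f t.

(** Differentiating t g'(t) gives g' + t g''; the extra g' raises [b] by one. *)
Lemma is_derive_euler_Derive_n (b : R) (f : R -> R) (m : nat) (x : R) :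
  smooth_pos f -> 0 < x ->
  is_derive (euler b (Derive_n f m)) x (euler (b + 1) (Derive_n f (S m)) x).
Proof.
intros hf hx; unfold euler.
pose proof (smooth_pos_is_derive f m x hf hx) as H0.
pose proof (smooth_pos_is_derive f (S m) x hf hx) as H1.
evar_last.
- apply @is_derive_plus.
  + apply is_derive_scal; exact H0.
  + apply @is_derive_mult; [apply @is_derive_id | exact H1 | exact Rmult_comm].
- unfold plus, mult, one; simpl; ring.
Qed.

Lemma Derive_n_euler (b : R) (f : R -> R) (m : nat) (x : R) :
  smooth_pos f -> 0 < x ->
  Derive_n (euler b f) m x = euler (b + INR m) (Derive_n f m) x.
Proof.
intros hf; revert x; induction m as [|m IH]; intros x hx.
- simpl; now rewrite Rplus_0_r.
- change (Derive (Derive_n (euler b f) m) x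
          = euler (b + INR (S m)) (Derive_n f (S m)) x).
  rewrite (Derive_ext_loc _ (euler (b + INR m) (Derive_n f m)))
    by (apply locally_pos; [exact hx | exact IH]).
  rewrite (is_derive_unique _ _ _ (is_derive_euler_Derive_n _ f m x hf hx)).
  now rewrite S_INR, Rplus_assoc.
Qed.

(** Lets the induction on [k] in [is_derive_c] pass from [f] to [euler b f]. *)
Lemma smooth_pos_euler (b : R) (f : R -> R) :
  smooth_pos f -> smooth_pos (euler b f).
Proof.
intros hf [|m] x hx; [exact I|].
apply ex_derive_ext_loc with (euler (b + INR m) (Derive_n f m)).
- apply locally_pos; [exact hx|].
  intros t ht; symmetry; now apply Derive_n_euler.
- eexists; now apply is_derive_euler_Derive_n.
Qed.

Lemma c_ext (lambda : R) (k : nat) (f g : R -> R) (x : R) :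
  0 < x -> (forall t, 0 < t -> f t = g t) -> c lambda k f x = c lambda k g x.
Proof.
intros hx hfg; unfold c; f_equal.
apply Derive_n_ext_loc, locally_pos; [exact hx|].
intros t ht; now rewrite hfg.
Qed.

Lemma c_0 (lambda : R) (f : R -> R) (x : R) : 0 < x -> c lambda 0 f x = f x.
Proof.
intros hx; unfold c; simpl.
rewrite <- Rmult_assoc, <- Rpower_plus.
replace (1 - lambda + (lambda - 1 + 0)) with 0 by ring.
now rewrite Rpower_O, Rmult_1_l.
Qed.

(** The innermost derivative is carried out: (t^(lambda+k) f)' = t^(lambda+k-1) ((lambda+k) f + t
    f'), and the power left over is the weight of [c lambda k]. *)
Lemma c_S (lambda : R) (k : nat) (f : R -> R) (x : R) :
  smooth_pos f -> 0 < x ->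
  c lambda (S k) f x = c lambda k (euler (lambda + INR k) f) x.
Proof.
intros hf hx; unfold c; f_equal.
(* Folding into [h] shields the [S k] of the exponent from the rewrite that splits the order of
   differentiation as [k + 1]. *)
set (h := fun t => _ * f t); rewrite <- Nat.add_1_r, <- (Derive_n_comp h k 1).
apply Derive_n_ext_loc, locally_pos; [exact hx|].
intros t ht; apply is_derive_unique.
evar_last.
- apply @is_derive_mult;
    [now apply is_derive_Rpower | exact (smooth_pos_is_derive f 0 t hf ht)
    | exact Rmult_comm].
- unfold plus, mult, euler; simpl Derive_n; cbn -[INR].
  rewrite S_INR.
  replace (lambda - 1 + (INR k + 1) - 1) with (lambda - 1 + INR k) by ring.
  replace (lambda - 1 + (INR k + 1)) with (lambda - 1 + INR k + 1) by ring.
  rewrite (Rpower_plus (lambda - 1 + INR k) 1 t), (Rpower_1 t ht).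
  change (fun y => f y) with f; ring.
Qed.

(** Differentiation moves past each factor theta + lambda + j and turns it into theta + (lambda + 1)
    + j. The induction keeps [f] general, since its hypothesis is applied to
    [euler (lambda + INR k) f]. *)
Lemma is_derive_c (lambda : R) (k : nat) (f : R -> R) (x : R) :
  smooth_pos f -> 0 < x ->
  is_derive (c lambda k f) x (c (lambda + 1) k (Derive f) x).
Proof.
revert f x; induction k as [|k IH]; intros f x hf hx.
- rewrite (c_0 _ _ x hx).
  apply is_derive_ext_loc with f.
  + apply locally_pos; [exact hx|]; intros t ht; now rewrite c_0.
  + exact (smooth_pos_is_derive f 0 x hf hx).
- apply is_derive_ext_loc with (c lambda k (euler (lambda + INR k) f)).
  + apply locally_pos; [exact hx|]; intros t ht; now rewrite c_S.
  + rewrite c_S by (try apply smooth_pos_Derive; assumption).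
    (* The commutation rule is read backwards, to give the argument of [c] the form [Derive g] that
       the induction hypothesis expects. *)
    rewrite (c_ext _ _ _ (Derive (euler (lambda + INR k) f)) x hx).
    * apply IH; [now apply smooth_pos_euler | exact hx].
    * intros t ht; symmetry.
      replace (lambda + 1 + INR k) with (lambda + INR k + 1) by ring.
      exact (is_derive_unique _ _ _
               (is_derive_euler_Derive_n (lambda + INR k) f 0 t hf ht)).
Qed.

Lemma smooth_pos_Derive_n (f : R -> R) (n : nat) :
  smooth_pos f -> smooth_pos (Derive_n f n).
Proof.
intros hf; induction n as [|n IH]; [exact hf | exact (smooth_pos_Derive _ IH)].
Qed.

Lemma Derive_n_c (lambda : R) (k n : nat) (f : R -> R) (x : R) :
  smooth_pos f -> 0 < x ->
  Derive_n (c lambda k f) n x = c (lambda + INR n) k (Derive_n f n) x.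
Proof.
intros hf; revert x; induction n as [|n IH]; intros x hx.
- simpl; now rewrite Rplus_0_r.
- change (Derive (Derive_n (c lambda k f) n) x
          = c (lambda + INR (S n)) k (Derive (Derive_n f n)) x).
  rewrite (Derive_ext_loc _ (c (lambda + INR n) k (Derive_n f n)))
    by (apply locally_pos; [exact hx | exact IH]).
  rewrite S_INR, <- Rplus_assoc.
  apply is_derive_unique, is_derive_c; [now apply smooth_pos_Derive_n | exact hx].
Qed.

Theorem proposition1p3 (lambda : R) (f : R -> R)
  (hlambda : 0 < lambda) (hf : smooth_pos f) :
  forall (n k : nat) (x : R), 0 < x ->
    T lambda n k f x = (-1) ^ n * Derive_n (c lambda k f) n x.
Proof.
intros n k x hx.
rewrite (Derive_n_c lambda k n f x hf hx); unfold T, c.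
rewrite Rmult_assoc.
(* Both weights of [T] are those of [c] with parameter [lambda + INR n]. *)
replace (- (INR n + lambda - 1)) with (1 - (lambda + INR n)) by ring.
replace (INR k + INR n + lambda - 1) with (lambda + INR n - 1 + INR k) by ring.
reflexivity.
Qed.
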